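(* Let $E$ be a (possibly infinite) set, let $n\in\mathbb{N}$, and let $E_0,\dots,E_{n-1}$ be pairwise disjoint sets with $E=\bigcup_{i<n}E_i$. For each $i<n$ let $U_i$ be a uniform matroid on $E_i$, and let $N=\bigoplus_{i<n}U_i$. Let $M$ be an arbitrary matroid on $E$. Then the pair $\{M,N\}$ has the Intersection property: there is a set $I$ independent in both $M$ and $N$ together with a partition $I=I_M\sqcup I_N$ such that $\mathsf{span}_M(I_M)\cup\mathsf{span}_N(I_N)=E$.
   Context: Matroids are possibly infinite (B-)matroids: a matroid on $E$ is a pair $(E,\mathcal{I})$ with $\mathcal{I}\subseteq\mathcal{P}(E)$ such that (i) $\varnothing\in\mathcal{I}$; (ii) $\mathcal{I}$ is closed under subsets; (iii) for all $I,J\in\mathcal{I}$ with $J$ $\subseteq$-maximal in $\mathcal{I}$ and $I$ not maximal, there is $e\in J\setminus I$ with $I\cup\{e\}\in\mathcal{I}$; (iv) for every $X\subseteq E$, every $I\in\mathcal{I}$ with $I\subseteq X$ extends to a $\subseteq$-maximal element of $\{J\in\mathcal{I}:J\subseteq X\}$. Sets in $\mathcal{I}$ are independent, maximal ones are bases. For $X\subseteq E$, $\mathsf{span}_M(X)$ consists of $X$ together with all $e\in E\setminus X$ such that $B_X\cup\{e\}$ is dependent, where $B_X$ is a maximal independent subset of $X$. A matroid $(E,\mathcal{I})$ is uniform if for every $I\in\mathcal{I}$, $e\in I$ and $f\in E\setminus I$ we have $(I\setminus\{e\})\cup\{f\}\in\mathcal{I}$. For matroids $M_i$ on pairwise disjoint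 sets $E_i$, the direct sum $\bigoplus_i M_i$ is the matroid on $\bigcup_i E_i$ in which $I$ is independent iff $I\cap E_i$ is independent in $M_i$ for all $i$. *)

(* Defs.v *)
From mathcomp Require Import all_boot.
From mathcomp Require Import boolp classical_sets.

Set Implicit Arguments.
Unset Strict Implicit.
Unset Printing Implicit Defensive.

Local Open Scope classical_set_scope.

Definition subset_maximal (T : Type) (F : set (set T)) (J : set T) : Prop :=
  F J /\ forall K : set T, F K -> J `<=` K -> K = J.

(* Possibly infinite (B-)matroids with ground set E. *)
Record matroid (T : Type) (E : set T) : Type := Matroid {
  indep : set (set T);
  indep_ground : forall I, indep I -> I `<=` E;
  indep0 : indep set0;
  indep_subset : forall I J, indep J -> I `<=` J -> indep I;
  indep_augment : forall I J,
    indep I -> subset_maximal indep J -> ~ subset_maximal indep I ->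
    exists e, [/\ J e, ~ I e & indep (I `|` [set e])];
  indep_maximal : forall X I, X `<=` E -> indep I -> I `<=` X ->
    exists2 B, I `<=` B & subset_maximal [set J | indep J /\ J `<=` X] B
}.

Section MatroidNotions.
Variables (T : Type) (E : set T).

(* The set does not depend on the choice of the maximal independent B. *)
Definition span (M : matroid E) (X : set T) : set T :=
  X `|` [set e | [/\ E e, ~ X e &
    exists2 B, subset_maximal [set J | indep M J /\ J `<=` X] B
             & ~ indep M (B `|` [set e])]].

Definition uniform (M : matroid E) : Prop :=
  forall (I : set T) (e f : T), indep M I -> I e -> E f -> ~ I f ->
    indep M ((I `\ e) `|` [set f]).

Definition intersection_property (M N : matroid E) : Prop :=
  exists I IM IN : set T,
    [/\ indep M I, indep N I, I = IM `|` IN, IM `&` IN = set0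
      & span M IM `|` span N IN = E].

End MatroidNotions.

Section DirectSum.
Variables (T : Type) (E : set T) (K : Type) (E_ : K -> set T).
Hypothesis EE : E = \bigcup_i E_ i.
Hypothesis disjE : trivIset setT E_.
Variable U : forall i, matroid (E_ i).

Definition direct_sum_indep : set (set T) :=
  [set I | I `<=` E /\ forall i, indep (U i) (I `&` E_ i)].

Let sub_E i : E_ i `<=` E.
Proof. by rewrite EE => x Ex; exists i. Qed.

Let same_index i j x : E_ i x -> E_ j x -> i = j.
Proof. by move=> ix jx; apply: disjE => //; exists x. Qed.

Let replace_indep I i B : direct_sum_indep I -> indep (U i) B ->
  direct_sum_indep ((I `\` E_ i) `|` B).
Proof.
move=> [IE Iind] Bind; have BE := indep_ground Bind; split.
  by move=> x [[/IE]|/BE/sub_E].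
move=> j; have [<-|ij] := pselect (i = j).
  by apply: indep_subset Bind _ => x [[[? ?]|]].
apply: indep_subset (Iind j) _ => x [[[Ix _]|/BE ix] jx]; first by split.
by case: ij; apply: same_index jx.
Qed.

Let replace_cap I i B : B `<=` E_ i -> ((I `\` E_ i) `|` B) `&` E_ i = B.
Proof.
move=> BE; apply/seteqP; split=> [x [[[? ?]|]] //|x Bx].
by split; [right|exact: BE].
Qed.

Let maximal_cap J i : subset_maximal direct_sum_indep J ->
  subset_maximal (indep (U i)) (J `&` E_ i).
Proof.
move=> [Jind Jmax]; split; first exact: Jind.2.
move=> B Bind JB; have BE := indep_ground Bind.
have := Jmax _ (replace_indep Jind Bind); move=> <-; first by rewrite replace_cap.
move=> x Jx; have [ix|nix] := pselect (E_ i x); last by left.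
by right; apply: JB.
Qed.

Let maximal_of_cap J : direct_sum_indep J ->
  (forall i, subset_maximal (indep (U i)) (J `&` E_ i)) ->
  subset_maximal direct_sum_indep J.
Proof.
move=> Jind Jmax; split=> // L [LE Lind] JL; apply/seteqP; split=> // x Lx.
have := LE _ Lx; rewrite EE => -[i _ ix].
have : (L `&` E_ i) x by [].
by rewrite ((Jmax i).2 _ (Lind i)); [case|exact: setSI].
Qed.

Fact direct_sum_ground I : direct_sum_indep I -> I `<=` E.
Proof. by case. Qed.

Fact direct_sum_indep0 : direct_sum_indep set0.
Proof. by split=> // i; rewrite set0I; exact: indep0. Qed.

Fact direct_sum_subset I J :
  direct_sum_indep J -> I `<=` J -> direct_sum_indep I.
Proof.
move=> [JE Jind] IJ; split; first exact: subset_trans JE.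
by move=> i; apply: indep_subset (Jind i) _; exact: setSI.
Qed.

Fact direct_sum_augment I J :
  direct_sum_indep I -> subset_maximal direct_sum_indep J ->
  ~ subset_maximal direct_sum_indep I ->
  exists e, [/\ J e, ~ I e & direct_sum_indep (I `|` [set e])].
Proof.
move=> Iind Jmax nImax.
have [i nIi] : exists i, ~ subset_maximal (indep (U i)) (I `&` E_ i).
  by apply/existsNP => Imax; apply: nImax; exact: maximal_of_cap.
have [e [[Je ie] nIe Ieind]] :=
  indep_augment (Iind.2 i) (maximal_cap i Jmax) nIi.
exists e; split=> //; first by move=> Ie; apply: nIe.
apply: direct_sum_subset (replace_indep Iind Ieind) _ => x [Ix|->].
- by have [ix|nix] := pselect (E_ i x); [right; left|left].
- by right; right.
Qed.

Fact direct_sum_maximal X I : X `<=` E -> direct_sum_indep I -> I `<=` X ->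
  exists2 B, I `<=` B &
    subset_maximal [set J | direct_sum_indep J /\ J `<=` X] B.
Proof.
move=> XE [IE Iind] IX.
have /choice[B BP] : forall i, exists B, I `&` E_ i `<=` B /\
    subset_maximal [set J | indep (U i) J /\ J `<=` X `&` E_ i] B.
  move=> i; have [B IB Bmax] := @indep_maximal _ _ (U i) (X `&` E_ i) _
    (@subIsetr _ _ _) (Iind i) (@setSI _ _ _ _ IX).
  by exists B.
have BX i : B i `<=` X `&` E_ i by case: (BP i) => _ [[]].
have Bind i : indep (U i) (B i) by case: (BP i) => _ [[]].
have capB i : (\bigcup_j B j) `&` E_ i = B i.
  apply/seteqP; split=> [x [[j _ Bx] ix]|x Bx].
    by rewrite (same_index ix (BX _ _ Bx).2).
  by split; [exists i|exact: (BX _ _ Bx).2].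
exists (\bigcup_j B j).
  by move=> x Ix; have := IE _ Ix; rewrite EE => -[i _ ix]; exists i => //;
    apply: (BP i).1.
have UX : \bigcup_j B j `<=` X by move=> x [i _ /BX[]].
split; first by split=> //; split=> [|i]; [exact: subset_trans XE|rewrite capB].
move=> L [[LE Lind] LX] BL; apply/seteqP; split=> // x Lx.
have := LE _ Lx; rewrite EE => -[i _ ix]; exists i => //.
have [_ [_ Bmax]] := BP i.
rewrite -(Bmax (L `&` E_ i)) //; first by split=> //; exact: setSI.
by rewrite -capB; exact: setSI.
Qed.

Definition direct_sum : matroid E :=
  Matroid direct_sum_ground direct_sum_indep0 direct_sum_subset
    direct_sum_augment direct_sum_maximal.

End DirectSum.

(* Main.v *)
Require Import Defs.
From mathcomp Require Import all_boot.
From mathcomp Require Import boolp classical_sets.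

Local Open Scope classical_set_scope.

(** A push-relabel argument. A set independent in a uniform matroid is a base or
    can be extended by any point, so a dependent set contains a base. Take an
    [M]-independent set [C] and give each class [E_ i] a height [h i <= n] such
    that the classes of height [< k] are [M]-spanned by the part of [C] in the
    classes of height [<= k]; only classes in which [C] is spanning may have
    positive height. A class of height [< n] in which [C] is dependent pushes its
    surplus, all at once and however infinite, to the classes below: either it
    drops to a base of its uniform matroid, or it stays spanning and its height
    can be increased. As only finitely many heights are involved this stops with
    [C] independent in all classes of height [< n]. The [n] classes miss one of
    the heights [0, ..., n], say [k]; then [IM] is the part of [C] below [k] and
    [IN] consists of bases of the classes above [k]. *)

(** * Closure in infinite matroids *)

Section Closure.
Context {T : Type} {E : set T} (M : matroid E).
Implicit Types P Q X Z : set T.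

(* For independent [P] this is [span M P] together with the points off [E]. *)
Definition cl P : set T := P `|` [set e | ~ indep M (P `|` [set e])].

Lemma clN {P e} : ~ cl P e -> ~ P e /\ indep M (P `|` [set e]).
Proof. by move=> /not_orP[? /contrapT]. Qed.

Lemma subset_cl P : P `<=` cl P.
Proof. by move=> x; left. Qed.

Lemma clS {P Q} : P `<=` Q -> cl P `<=` cl Q.
Proof.
move=> PQ x [/PQ|Px]; first by left.
by right=> Qx; apply: Px; apply: indep_subset Qx _; apply: setSU.
Qed.

Lemma subset_maximal_cl X P : indep M P -> P `<=` X -> X `<=` cl P ->
  subset_maximal [set J | indep M J /\ J `<=` X] P.
Proof.
move=> Pi PX XP; split=> // K [Ki KX] PK; apply/seteqP; split=> // x Kx.
have [//|nPx] := XP _ (KX _ Kx); exfalso; apply: nPx.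
by apply: indep_subset Ki _ => y [/PK|->].
Qed.

Lemma maximal_indep_cl X I : X `<=` E -> indep M I -> I `<=` X ->
  exists B, [/\ indep M B, I `<=` B, B `<=` X & X `<=` cl B].
Proof.
move=> XE Ii IX; have [B IB [[Bi BX] Bmax]] := indep_maximal XE Ii IX.
exists B; split=> // x Xx; apply: contrapT => /clN[nBx Bxi]; apply: nBx.
rewrite -(Bmax (B `|` [set x])); [by right| |exact: subsetUl].
by split=> // y [/BX|->].
Qed.

Lemma base_of_subset_maximal B : subset_maximal (indep M) B ->
  forall e, indep M (B `|` [set e]) -> B e.
Proof. by move=> [_ Bmax] e Bei; rewrite -(Bmax _ Bei (@subsetUl _ _ _)); right. Qed.

Lemma not_base_extend I B : indep M I -> subset_maximal (indep M) B ->
  (exists2 f, ~ I f & indep M (I `|` [set f])) ->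
  exists e, [/\ B e, ~ I e & indep M (I `|` [set e])].
Proof.
move=> Ii Bb [f nIf Ifi]; apply: indep_augment => // Ib.
exact/nIf/(base_of_subset_maximal _ Ib).
Qed.

(* The augmentation axiom, relativised to [X]. Completing [P] to a base [B] of
   [M] and [Q] by elements of [B] off [X], failure of augmentation makes the
   completion [Q'] of [Q] a base; exchanging [f] into it costs one element
   [r] off [X], and refilling [B] without [r] then enlarges [P] inside [X]. *)
Lemma augment_cl X P Q f : X `<=` E -> indep M P -> P `<=` X -> X `<=` cl P ->
  indep M Q -> Q `<=` X -> X f -> ~ Q f -> indep M (Q `|` [set f]) ->
  exists e, [/\ P e, ~ Q e & indep M (Q `|` [set e])].
Proof.
move=> XE Pi PX XP Qi QX Xf nQf Qfi; apply: contrapT => noaug.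
have ME := @indep_ground _ _ M.
have [B PB] := indep_maximal (@subset_refl _ E) Pi (ME _ Pi).
move=> [[Bi BE] Bmax0].
have Bb : subset_maximal (indep M) B.
  by split=> // K Ki BK; apply: Bmax0 => //; split=> //; exact: ME.
have BXP e : B e -> X e -> P e.
  move=> Be /XP[//|nPe]; exfalso; apply: nPe.
  by apply: indep_subset Bi _ => y [/PB|->].
have [|//||Q' [Q'i QQ' Q'sub Q'cl]] :=
    maximal_indep_cl (Q `|` (B `\` X)) Q.
- by move=> x [/QX/XE|[/BE]].
- exact: subsetUl.
have Q'b : subset_maximal (indep M) Q'.
  apply: contrapT => /(indep_augment Q'i Bb)[e [Be nQ'e Q'ei]].
  have [Xe|nXe] := pselect (X e).
    apply: noaug; exists e; split; first exact: BXP.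
      by move/QQ'.
    by apply: indep_subset Q'ei _; exact: setSU.
  by have [|//|] := Q'cl e; first by right.
have [|//||Q2 [Q2i QfQ2 Q2sub Q2cl]] :=
    maximal_indep_cl (Q' `|` [set f]) (Q `|` [set f]).
- by move=> x [/(ME _ Q'i)|->]; [|exact: XE].
- exact: setSU.
have Q2f : Q2 f by apply: QfQ2; right.
have nQ'f : ~ Q' f.
  by move=> /Q'sub[|[_]].
have nQ2 x : Q' x -> ~ Q2 x -> ~ indep M (Q2 `|` [set x]).
  by move=> Q'x nQ2x; have [|//|] := Q2cl x; first by left.
have Q2b : subset_maximal (indep M) Q2.
  apply: contrapT => /(indep_augment Q2i Q'b)[e [Q'e nQ2e]].
  exact: nQ2.
have [r Q'r nQ2r] : exists2 r, Q' r & ~ Q2 r.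
  apply: contrapT => h; apply: nQ'f; apply: (base_of_subset_maximal _ Q'b).
  apply: indep_subset Q2i _ => y [Q'y|->//].
  by apply: contrapT => nQ2y; apply: h; exists y.
have nXr : ~ X r.
  by case: (Q'sub _ Q'r) => [Qr|[]//]; case: nQ2r; apply: QfQ2; left.
have Br : B r by case: (Q'sub _ Q'r) => [/QX|[]].
have [|//||e [Q2e nBre Brei]] := not_base_extend (B `\ r) Q2.
- by apply: indep_subset Bi _ => y [].
- by exists r; [case=> _; apply|apply: indep_subset Bi _ => y [[]|->]].
have er : e <> r by move=> er; apply: nQ2r; rewrite -er.
have nBe : ~ B e by move=> Be; apply: nBre.
have Xe : X e.
  case: (Q2sub _ Q2e) => [/Q'sub[/QX//|[]//]|->//].
have [/PB//|nPe] := XP _ Xe; apply: nPe.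
apply: indep_subset Brei _ => y [Py|->]; last by right.
by left; split; [exact: PB|move=> yr; apply: nXr; rewrite -yr; exact: PX].
Qed.

(** If [Q] could be extended by [e], augment it from a maximal independent subset of the union of
    [P] and [Q] that contains [P], hence spans [e]: the element gained would lie in [cl Q]. *)
Lemma cl_trans P Q : indep M P -> indep M Q -> P `<=` cl Q -> cl P `<=` cl Q.
Proof.
move=> Pi Qi PQ e [/PQ//|nPe]; apply: contrapT => /clN[nQe' Qei].
have ME := @indep_ground _ _ M.
have XE : P `|` Q `<=` E by move=> x [/(ME _ Pi)|/(ME _ Qi)].
have [B [Bi PB BX Bcl]] := maximal_indep_cl _ _ XE Pi (@subsetUl _ _ _).
have Ee : E e by apply: (ME _ Qei); right.
have [|//|||//|||//|//|x []] := augment_cl (P `|` Q `|` [set e]) B Q e.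
- by move=> x [/XE|->].
- by move=> x /BX; left.
- move=> x [/Bcl//|->]; right=> Bei; apply: nPe.
  by apply: indep_subset Bei _; exact: setSU.
- by move=> x Qx; left; right.
- by right.
- by move=> /BX[/PQ[//|nQx]|//] nQx' Qxi; exact: nQx.
Qed.

(** If [W], built up from [Q] inside the union of [Q1] and [Z], misses some [z] in [Z], augment [P]
    and [Z] minus [z] from [W]. The element gained would lie in [P], in [Q] or in [Z] minus [z], all
    of which are already contained or spanned. *)
Lemma indep_exchange P Q Z : indep M Q -> Q `<=` cl P -> indep M (P `|` Z) ->
  P `&` Z = set0 -> indep M (Q `|` Z).
Proof.
move=> Qi QP PZi PZ0.
have ME := @indep_ground _ _ M; have PZE := ME _ PZi; have QE := ME _ Qi.
have [|//||Q1 [Q1i QQ1 Q1sub Q1cl]] := maximal_indep_cl (P `|` Q) Q.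
- by move=> x [Px|/QE//]; apply: PZE; left.
- exact: subsetUr.
have [|//||W [Wi Q1W Wsub Wcl]] := maximal_indep_cl (Q1 `|` Z) Q1.
- by move=> x [/(ME _ Q1i)//|Zx]; apply: PZE; right.
- exact: subsetUl.
suff ZW : Z `<=` W by apply: indep_subset Wi _ => x [/QQ1/Q1W|/ZW].
move=> z Zz; apply: contrapT => nWz.
have Q1clW := clS Q1W.
have [|//||||||||w] := augment_cl (P `|` Q `|` Z) W (P `|` (Z `\ z)) z.
- by move=> x [[Px|/QE//]|Zx]; apply: PZE; [left|right].
- by move=> x /Wsub[/Q1sub|]; [left|right].
- by move=> x [/Q1cl/Q1clW//|Zx]; apply: Wcl; right.
- by apply: indep_subset PZi _ => x [|[]]; [left|right].
- by move=> x [Px|[Zx _]]; [left; left|right].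
- by right.
- move=> [Pz|[_ /(_ erefl)]]//; have : (P `&` Z) z by [].
  by rewrite PZ0.
- by apply: indep_subset PZi _ => x [[|[]]|->]; [left|right|right].
move=> [Ww nw wi].
have [/Q1sub[Pw|Qw]|Zw] := Wsub _ Ww.
- by apply: nw; left.
- have [Pw|] := QP _ Qw; first by apply: nw; left.
  by apply; apply: indep_subset wi _ => x [|->]; [left; left|right].
- by apply: nw; right; split=> // wz; apply: nWz; rewrite -wz.
Qed.

Lemma cl_span P : indep M P -> cl P `&` E `<=` span M P.
Proof.
move=> Pi x [[|nPx] Ex]; first by left.
have [|nP] := pselect (P x); [by left|right; split=> //].
by exists P => //; exact: subset_maximal_cl (@subset_refl _ _) (@subset_cl _).
Qed.

(** * Spanning sets and uniform matroids *)

Definition spanning X := exists2 B, subset_maximal (indep M) B & B `<=` X.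

Lemma spanningS X Y : X `<=` Y -> spanning X -> spanning Y.
Proof. by move=> XY [B Bb BX]; exists B => //; exact: subset_trans XY. Qed.

Lemma spanning_base X I : X `<=` E -> spanning X -> indep M I -> I `<=` X ->
  exists B, [/\ subset_maximal (indep M) B, I `<=` B & B `<=` X].
Proof.
move=> XE [B0 B0b B0X] Ii IX.
have [B [Bi IB BX Bcl]] := maximal_indep_cl _ _ XE Ii IX.
exists B; split=> //; apply: contrapT => /(indep_augment Bi B0b)[e [B0e nBe Bei]].
by have [] := Bcl _ (B0X _ B0e).
Qed.

(** A maximal independent subset [B] of [X] misses some [y] in [X]. If [B] could be extended by a
    point [e], uniformity would replace [e] by [y], against maximality. *)
Lemma uniform_dependent_spanning X : uniform M -> X `<=` E -> ~ indep M X ->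
  spanning X.
Proof.
move=> Mu XE nX.
have [B [Bi _ BX Bcl]] := maximal_indep_cl _ _ XE (indep0 M) (@sub0set _ _).
have [y Xy nBy] : exists2 y, X y & ~ B y.
  apply: contrapT => h; apply: nX; apply: indep_subset Bi _ => y Xy.
  by apply: contrapT => nBy; apply: h; exists y.
have [//|nByi] := Bcl _ Xy.
exists B => //; split=> // K Ki BK; apply/seteqP; split=> // e Ke.
apply: contrapT => nBe.
have Bei : indep M (B `|` [set e]) by apply: indep_subset Ki _ => x [/BK|->].
have [ye|ye] := pselect (y = e); first by apply: nByi; rewrite ye.
have nBey : ~ (B `|` [set e]) y by case.
apply: nByi; apply: indep_subset (Mu _ e _ Bei _ (XE _ Xy) nBey) _; first by right.
move=> x [Bx|->]; last by right.
by left; split; [left|move=> xe; apply: nBe; rewrite -xe].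
Qed.

End Closure.

(** * Push-relabel *)

Section PushRelabel.
Context {T : Type} {E : set T} {n : nat} (E_ : 'I_n -> set T).
Hypothesis EE : E = \bigcup_i E_ i.
Hypothesis disjE : trivIset setT E_.
Context (U : forall i : 'I_n, matroid (E_ i)).
Hypothesis unifU : forall i : 'I_n, uniform (U i).
Context (M : matroid E).
Implicit Types (C Q : set T) (h : 'I_n -> nat) (i j : 'I_n).

Definition below h k : set T := [set x | exists2 i, E_ i x & h i < k].

(* The condition on [below] says that heights drop by at most one along the
   exchange arcs of [C]. *)
Definition valid_state C h := [/\ indep M C, forall i, h i <= n,
  forall k, below h k `<=` cl M (C `&` below h k.+1)
  & forall i, 0 < h i -> spanning (U i) (C `&` E_ i)].

Definition raise h i : 'I_n -> nat := fun j => h j + (j == i).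

Lemma class_unique i j x : E_ i x -> E_ j x -> i = j.
Proof. by move=> ix jx; apply: disjE => //; exists x. Qed.

Lemma class_ground i : E_ i `<=` E.
Proof. by rewrite EE => x ix; exists i. Qed.

Lemma below_ground h k : below h k `<=` E.
Proof. by move=> x [i /class_ground]. Qed.

Lemma belowS h k l : k <= l -> below h k `<=` below h l.
Proof. by move=> kl x [i ix hk]; exists i => //; exact: leq_trans kl. Qed.

Lemma below_class h k i x : E_ i x -> below h k x -> h i < k.
Proof. by move=> ix [j jx]; rewrite (class_unique _ _ _ ix jx). Qed.

Lemma below_raise h i k : below (raise h i) k `<=` below h k.
Proof. by move=> x [j jx hj]; exists j => //; exact: leq_ltn_trans (leq_addr _ _) hj. Qed.

Lemma below_raiseN h i k x : below h k x -> ~ E_ i x -> below (raise h i) k x.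
Proof.
move=> [j jx hj] nix; exists j => //; rewrite /raise.
by case: eqP => [ji|]; [rewrite ji in jx|rewrite addn0].
Qed.

(** The step shared by both outcomes of [discharge]: [Q] replaces the part of [C] of height at most
    [h i]. The closure condition survives because below height [h i] the set only grows, and from
    there on [Q] spans what it replaces. *)
Lemma push C h i Q (C' := Q `|` (C `\` below h (h i).+1)) :
  valid_state C h -> indep M Q ->
  (C `&` below h (h i).+1) `\` E_ i `<=` Q ->
  Q `<=` (C `&` below h (h i).+1) `|` below h (h i) ->
  C `&` below h (h i).+1 `<=` cl M Q ->
  spanning (U i) (Q `&` E_ i) ->
  [/\ valid_state C' h, C' `&` E_ i = Q `&` E_ i
    & forall j, j <> i -> h i <= h j -> C' `&` E_ j = C `&` E_ j].
Proof.
set l := h i => -[Ci hn hcl hsp] Qi PQ Qsub Qcl Qsp.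
have CQ x : C x -> ~ E_ i x -> C' x.
  move=> Cx nix; have [bx|nbx] := pselect (below h l.+1 x); last by right.
  by left; apply: PQ.
have C'i : C' `&` E_ i = Q `&` E_ i.
  apply/seteqP; split=> [x [[Qx|[Cx nbx]] ix]|x [Qx ix]] //; last by split=> //; left.
  by case: nbx; exists i.
have C'ind : indep M C'.
  apply: (indep_exchange M (C `&` below h l.+1)) => //.
  - by move=> x /Qsub[|/hcl//]; left.
  - by apply: indep_subset Ci _ => x [[]|[]].
  - by apply/seteqP; split=> // x [[_ bx] [_]].
split=> //.
- split=> // [k|j hj].
    have [kl|lk] := ltnP k l.
      apply: subset_trans (hcl k) (clS _ _) => x [Cx bx]; split=> //.
      by apply: CQ => // ix; have := below_class _ _ _ _ ix bx; rewrite ltnNge kl.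
    apply: subset_trans (hcl k) (cl_trans M _ _ _ _ _).
    + by apply: indep_subset Ci _ => x [].
    + by apply: indep_subset C'ind _ => x [].
    + move=> x [Cx bx]; have [blx|nblx] := pselect (below h l.+1 x); last first.
        by left; split=> //; right.
      suff QC' : Q `<=` C' `&` below h k.+1 by apply: (clS M QC'); exact: Qcl.
      move=> y Qy; split; first by left.
      by case: (Qsub _ Qy) => [[_]|]; apply: belowS; rewrite ?ltnS // ltnW.
  have [->|ji] := eqVneq j i; first by rewrite C'i.
  apply: spanningS (hsp _ hj) => x [Cx jx]; split=> //; apply: CQ => // ix.
  by move/eqP: ji; apply; exact: class_unique jx ix.
- move=> j ji lj; apply/seteqP; split=> [x [[/Qsub[[Cx _]|bx]|[Cx _]] jx]|x [Cx jx]] //.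
    by have := below_class _ _ _ _ jx bx; rewrite ltnNge lj.
  by split=> //; apply: CQ => // ix; apply: ji; exact: class_unique jx ix.
Qed.

(* Exchange as much of [C `&` E_ i] as possible for elements of lower classes.
   If what remains still spans [U i] then [i] can be raised; otherwise the
   exchange is cut short so that a base of [U i] remains. *)
Lemma discharge C h i : valid_state C h -> ~ indep (U i) (C `&` E_ i) -> h i < n ->
  exists C', valid_state C' (raise h i) \/
    [/\ valid_state C' h, indep (U i) (C' `&` E_ i)
      & forall j, j <> i -> h i <= h j -> C' `&` E_ j = C `&` E_ j].
Proof.
set l := h i => st nCi hin; have [Ci hn hcl hsp] := st.
have ME := @indep_ground _ _ M; have CE := ME _ Ci.
have Csp := uniform_dependent_spanning _ _ (unifU i) (@subIsetr _ _ _) nCi.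
pose P := (C `&` below h l.+1) `\` E_ i.
have PC : P `<=` C by move=> x [[]].
(* [D] avoids class [i] and spans all lower classes; [Q] then retains from class [i] only enough to
   span the rest of [C] there. *)
have [|||D [Di PD Dsub Dcl]] := maximal_indep_cl M (P `|` below h l) P.
- by move=> x [/PC/CE|/below_ground].
- exact: indep_subset Ci _.
- exact: subsetUl.
have Dni x : D x -> ~ E_ i x.
  move=> /Dsub[[]//|bx] ix.
  by have := below_class _ _ _ _ ix bx; rewrite ltnn.
have [|//||Q [Qi DQ Qsub Qcl]] := maximal_indep_cl M (D `|` (C `&` E_ i)) D.
- by move=> x [/(ME _ Di)|[/CE]].
- exact: subsetUl.
have CD : C `&` below h l.+1 `<=` D `|` (C `&` E_ i).
  move=> x [Cx bx]; have [ix|nix] := pselect (E_ i x); first by right.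
  by left; apply: PD.
have DP x : D x -> ((C `&` below h l.+1) `|` below h l) x.
  by move=> /Dsub[[]|]; [left|right].
have iC x : C x -> E_ i x -> ((C `&` below h l.+1) `|` below h l) x.
  by move=> Cx ix; left; split=> //; exists i.
have [Qsp|nQsp] := pselect (spanning (U i) (Q `&` E_ i)).
  have [|||//|] := push C h i Q st Qi.
  - exact: subset_trans PD DQ.
  - by move=> x /Qsub[/DP|[Cx ix]] //; exact: iC.
  - exact: subset_trans CD Qcl.
  set C' := _ `|` _ => -[C'i _ C'cl C'sp] C'Q _.
  exists C'; left; split=> // [j|k|j].
  - by rewrite /raise; case: eqP => [->|_]; rewrite ?addn1 ?addn0.
  (* Raising [i] shrinks [below h k.+1] only for [k = l], where [E_ i] drops out; there [D], which
     avoids [E_ i], does the spanning. *)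
  - have [->|kl] := eqVneq k l; last first.
      move=> x /below_raise/C'cl; apply: clS => y [C'y [j jy hj]]; split=> //.
      exists j => //; rewrite /raise; case: eqP => [ji|]; last by rewrite addn0.
      by move: hj kl; rewrite ji -/l addn1 ltnS [in X in _ -> _ -> X]ltnS ltn_neqAle eq_sym => -> ->.
    move=> x /below_raise bx; have := Dcl x (or_intror bx); apply: clS => y Dy.
    split; first by left; apply: DQ.
    apply: below_raiseN; last exact: Dni.
    by case: (DP _ Dy) => [[]//|]; exact: belowS.
  - have [->|ji] := eqVneq j i; first by rewrite C'Q.
    by rewrite /raise (negbTE ji) addn0; exact: C'sp.
have QC : Q `&` E_ i `<=` C `&` E_ i.
  by move=> x [/Qsub[/Dni|[]] //].
have Qii : indep (U i) (Q `&` E_ i).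
  apply: contrapT => nQ; apply: nQsp.
  exact: uniform_dependent_spanning (unifU i) (@subIsetr _ _ _) nQ.
(* [B] is the base that stays in class [i]. As [B] contains what [Q] retained there, completing it
   by elements of [D] to [R] loses no span. *)
have [B [Bb QB BC]] := spanning_base _ _ _ (@subIsetr _ _ _) Csp Qii QC.
have PBC : P `|` B `<=` C by move=> x [/PC|/BC[]].
have [|||R [Ri PBR Rsub Rcl]] := maximal_indep_cl M ((P `|` B) `|` D) (P `|` B).
- by move=> x [/PBC/CE|/(ME _ Di)].
- exact: indep_subset Ci _.
- exact: subsetUl.
have RB : R `&` E_ i = B.
  apply/seteqP; split=> [x [/Rsub[[[]//|//]|/Dni//]]|x Bx].
  by split; [apply: PBR; right|exact: (BC _ Bx).2].
have QR : Q `<=` cl M R.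
  move=> x Qx; apply: Rcl; case: (Qsub _ Qx) => [|[Cx ix]]; first by right.
  by left; right; apply: QB.
have [||||C'st C'i C'j] := push C h i R st Ri.
- by move=> x Px; apply: PBR; left.
- by move=> x /Rsub[[[]|/BC[Cx ix]]|/DP//]; [left|exact: iC].
- by move=> x /CD/Qcl; apply: cl_trans.
- by rewrite RB; exists B.
eexists; right; split; [exact: C'st| |exact: C'j].
by rewrite C'i RB; case: Bb.
Qed.

(** * Termination *)

Definition active C i : bool := `[< ~ indep (U i) (C `&` E_ i) >].

(** With base [n.+1], one class outweighs all classes of smaller height together, so settling it
    pays for any lower classes that become active. *)
Definition excess C h := \sum_(i | active C i) n.+1 ^ h i.

Lemma excess_lt C C' h i : active C i -> ~~ active C' i ->
  (forall j, j <> i -> h i <= h j -> C' `&` E_ j = C `&` E_ j) ->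
  excess C' h < excess C h.
Proof.
move=> Ci nC'i C'C.
have lower : \sum_(j | h j < h i) n.+1 ^ h j < n.+1 ^ h i.
  case hi: (h i) => [|l]; first by rewrite big_pred0.
  apply: (@leq_ltn_trans (\sum_(j < n) n.+1 ^ l)); last first.
    by rewrite sum_nat_const card_ord expnS ltn_mul2r expn_gt0 /=.
  rewrite big_mkcond leq_sum // => j _; case: ifP => // hj.
  by rewrite leq_pexp2l // -ltnS -hi.
rewrite /excess [X in _ < X](bigD1 i) //=.
apply: leq_ltn_trans (_ : _ <= \sum_(j | h j < h i) n.+1 ^ h j
    + \sum_(j | active C j && (j != i)) n.+1 ^ h j) _; last by rewrite ltn_add2r.
rewrite big_mkcond [X in _ <= X + _]big_mkcond [X in _ <= _ + X]big_mkcond.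
rewrite -big_split leq_sum //= => j _; case: ifP => // C'j.
have ji : j != i by apply: contraNneq nC'i => <-.
rewrite ji andbT; have [_|lj] := ltnP (h j) (h i); first exact: leq_addr.
by move: C'j; rewrite /active C'C //; [move=> ->|exact/eqP].
Qed.

Lemma settled_state : exists C h,
  valid_state C h /\ forall i, h i < n -> indep (U i) (C `&` E_ i).
Proof.
have [C [Ci _ _ Ccl]] := maximal_indep_cl M _ _ (@subset_refl _ E) (indep0 M) (@sub0set _ _).
have : valid_state C (fun=> 0).
  split=> // k x bx; apply: clS (Ccl x _); last exact: below_ground bx.
  move=> y Cy; split=> //; have := indep_ground Ci Cy.
  by rewrite {1}EE => -[i _ iy]; exists i.
(* Lexicographic induction: raising a class lowers the total distance of the heights from [n];
   otherwise the heights stay and [excess] drops. *)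
move: (fun=> 0) => h; move: {2}(\sum_i (n - h i)) (erefl (\sum_i (n - h i))) => a.
elim/ltn_ind: a C h {Ci Ccl} => a IHa C h.
move: {2}(excess C h) (erefl (excess C h)) => b.
elim/ltn_ind: b C h => b IHb C h bE aE st.
have [[i [hin act]]|done] :=
    pselect (exists i, h i < n /\ ~ indep (U i) (C `&` E_ i)); last first.
  exists C, h; split=> // i hin; apply: contrapT => nCi.
  by apply: done; exists i.
have [C' [st'|[st' C'i C'j]]] := discharge _ _ _ st act hin.
  apply: (IHa _ _ C' (raise h i) erefl st'); rewrite -aE.
  rewrite (bigD1 i) //= [X in _ < X](bigD1 i) //= /raise eqxx addn1.
  rewrite -addSn leq_add // ?subnS ?prednK ?subn_gt0 //.
  by apply: leq_sum => j ji; rewrite (negbTE ji) addn0.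
apply: (IHb _ _ C' h erefl aE st'); rewrite -bE.
apply: (excess_lt _ _ _ i) => //; first exact/asboolP.
by apply/asboolPn => /(_ C'i).
Qed.

(** * The partition at a height gap *)

Lemma height_gap h : exists2 k, k <= n & forall i, h i <> k.
Proof.
apply: contrapT => nogap.
have /choice[f fP] : forall k : 'I_n.+1, exists i, h i = k.
  move=> k; apply: contrapT => hk; apply: nogap; exists k; first by rewrite -ltnS.
  by move=> i hi; apply: hk; exists i.
have /leq_card : injective f.
  by move=> k l fkl; apply: val_inj; rewrite /= -!fP fkl.
by rewrite !card_ord ltnn.
Qed.

End PushRelabel.

Theorem theorem1p4 (T : Type) (E : set T) (n : nat) (E_ : 'I_n -> set T)
    (EE : E = \bigcup_i E_ i) (disjE : trivIset setT E_)
    (U : forall i : 'I_n, matroid (E_ i))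
    (unifU : forall i : 'I_n, uniform (U i))
    (M : matroid E) :
  intersection_property M (direct_sum EE disjE U).
Proof.
have [C [h [[Ci hn hcl hsp] hind]]] := settled_state E_ EE disjE U unifU M.
have [k kn gap] := height_gap h.
(* Classes not above [k] get the dummy value [set0], which [IN] ignores. *)
have /choice[B BP] i : exists B, k < h i ->
    subset_maximal (indep (U i)) B /\ B `<=` C `&` E_ i.
  have [kh|_] := ltnP k (h i); last by exists set0.
  by have [B] := hsp i (leq_ltn_trans (leq0n k) kh); exists B.
pose IM := C `&` below E_ h k.
pose IN := [set x | exists2 i, k < h i & B i x].
have INC : IN `<=` C by move=> x [i /BP[_ BC] /BC[]].
have IMi : indep M IM by apply: indep_subset Ci _ => x [].
have INB i : k < h i -> IN `&` E_ i = B i.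
  move=> kh; apply/seteqP; split=> [x [[j kj Bx] ix]|x Bx].
    by rewrite (class_unique _ disjE _ _ _ ix ((BP _ kj).2 _ Bx).2).
  by split; [exists i|exact: ((BP _ kh).2 _ Bx).2].
have INE : IN `<=` E by exact: subset_trans (indep_ground Ci).
have IN0 i : h i < k -> IN `&` E_ i = set0.
  move=> hk; apply/seteqP; split=> // x [[j kj Bx] ix]; move: (kj).
  by rewrite -(class_unique _ disjE _ _ _ ix ((BP _ kj).2 _ Bx).2) ltnNge ltnW.
have Ni : indep (direct_sum EE disjE U) (IM `|` IN).
  split=> [x [[/(indep_ground Ci)]|/INE]|i] //; rewrite setIUl.
  have [hk|kh|] := ltngtP (h i) k; last by move/gap.
    rewrite IN0 // setU0; apply: indep_subset (hind i (leq_trans hk kn)) _.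
    by move=> x [[]].
  rewrite INB //; apply: indep_subset (BP _ kh).1.1 _ => x [[[_ bx] ix]|] //.
  by have := below_class _ disjE _ _ _ _ ix bx; rewrite ltnNge ltnW.
have INi : indep (direct_sum EE disjE U) IN.
  by apply: (indep_subset Ni); exact: subsetUr.
exists (IM `|` IN), IM, IN; split=> //.
- by apply: indep_subset Ci _ => x [[]|/INC].
- apply/seteqP; split=> // x [[Cx bx] [i kh /(BP _ kh).2[_ ix]]].
  by have := below_class _ disjE _ _ _ _ ix bx; rewrite ltnNge ltnW.
apply/seteqP; split=> [x [[[/(indep_ground Ci)]|[]]|[/INE|[]]] //|x Ex].
have := Ex; rewrite {1}EE => -[i _ ix].
(* No class has height [k], so [C] has the same part below [k.+1] as below [k], and the closure
   condition at [k] says that [IM] spans the lower classes. Each higher class is spanned by its base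
   [B i]. *)
have [hk|kh|] := ltngtP (h i) k; last by move/gap.
  left; apply: cl_span => //; split=> //.
  have bx : below E_ h k x by exists i.
  apply: clS (hcl _ _ bx) => y [Cy [j jy]]; rewrite ltnS leq_eqVlt.
  by move=> /orP[/eqP/gap//|hj]; split=> //; exists j.
right; apply: cl_span => //; split=> //.
have [Bx|nBx] := pselect (B i x); first by left; exists i.
right=> -[_ /(_ i)]; rewrite setIUl INB // => Bxi; apply: nBx.
apply: (base_of_subset_maximal _ _ (BP _ kh).1).
by apply: indep_subset Bxi _ => y [|->]; [left|right].
Qed.
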